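(* Let $T\in\mathcal{B}(\mathcal{H})$, $T\neq0$. Then for all $x,y\in\mathcal{H}$ $$\left|\langle Tx,Ty\rangle-\frac{\|T\|^2}{2}\langle x,y\rangle\right|\le\frac{\|T\|^2}{2}\|x\|\|y\|$$ and $$|\langle Tx,Ty\rangle|\le\left|\langle Tx,Ty\rangle-\frac{\|T\|^2}{2}\langle x,y\rangle\right|+\frac{\|T\|^2}{2}|\langle x,y\rangle|\le\frac{\|T\|^2}{2}\bigl(|\langle x,y\rangle|+\|x\|\|y\|\bigr).$$
   Context: $\mathcal{H}$ is a separable nontrivial complex Hilbert space and $\mathcal{B}(\mathcal{H})$ is the algebra of bounded linear operators on $\mathcal{H}$ with the operator norm. *)

(* Defs.v *)
From HB Require Import structures.
From mathcomp Require Import all_boot all_order all_algebra.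
From mathcomp Require Import all_classical all_reals all_analysis.
From mathcomp Require Import sesquilinear complex.

Set Implicit Arguments.
Unset Strict Implicit.
Unset Printing Implicit Defensive.

Import Order.TTheory GRing.Theory Num.Theory.
Import numFieldNormedType.Exports.

Local Open Scope classical_set_scope.
Local Open Scope ring_scope.
Local Open Scope complex_scope.

(* The scalar field is R[i] and, as for any normed module over R[i], norms
   take their (nonnegative real) values in R[i]. The inner product is linear
   in its first argument and conjugate-linear in the second one; the norm, and
   hence the topology and completeness, is the one it induces. *)
HB.mixin Record CompleteNormedModule_isHilbert (R : realType) H
    & CompleteNormedModule R[i] H := {
  inner : {dot H for (@Num.conj R[i])};
  inner_normE : forall x : H, inner x x = `|x| ^+ 2
}.

#[short(type="hilbertType")]
HB.structure Definition Hilbert (R : realType) :=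
  {H of CompleteNormedModule R[i] H & CompleteNormedModule_isHilbert R H}.

Definition nontrivial_space (V : zmodType) := exists x : V, x != 0.

Definition separable_space (T : topologicalType) :=
  exists2 S : set T, countable S & dense S.

Definition bounded_operator (R : realType) (H : hilbertType R)
    (T : {linear H -> H}) :=
  exists M : R, forall x : H, `|T x| <= M%:C * `|x|.

(* [complex.Re] only turns the R[i]-valued norm into an element of R, where
   suprema live. [sup] is 0 on sets that are not bounded above, so this is
   the operator norm only for bounded [T]. *)
Definition opnorm (R : realType) (H : hilbertType R) (T : {linear H -> H}) : R :=
  sup [set complex.Re `|T x| | x in [set x : H | `|x| <= 1]].

(* Main.v *)
Require Import Defs.
From HB Require Import structures.
From mathcomp Require Import all_boot all_order all_algebra.
From mathcomp Require Import all_classical all_reals all_analysis.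
From mathcomp Require Import sesquilinear complex ring.

(** Put [c = ||T||^2 / 2] and [B x y = <Tx,Ty> - c <x,y>]. The form [B] is
    Hermitian, and since [0 <= ||Tz||^2 <= 2c ||z||^2], its quadratic form obeys
    [|B z z| = | ||Tz||^2 - c ||z||^2 | <= c ||z||^2]: subtracting half of the
    top of the range centres it at 0, which is what halves the constant.
    For Hermitian forms, unlike general sesquilinear ones, a bound on the
    quadratic form passes with the same constant to the whole form
    ([hermitian_bound]), which gives the first inequality. The other two are the
    triangle inequality and the first one with [c |<x,y>|] added to both
    sides. *)

Set Implicit Arguments.
Unset Strict Implicit.
Unset Printing Implicit Defensive.

Import Order.TTheory GRing.Theory Num.Theory.
Import numFieldNormedType.Exports.

Local Open Scope ring_scope.
Local Open Scope complex_scope.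

Lemma parallelogram (R : realType) (H : hilbertType R) (u v : H) :
  `|u + v| ^+ 2 + `|u - v| ^+ 2 = 2 * (`|u| ^+ 2 + `|v| ^+ 2).
Proof. by rewrite -!inner_normE hnormD hnormB; ring. Qed.

(** Polarization: [B (u + v) (u + v) - B (u - v) (u - v)] is four times the
    real part of [B u v], and the parallelogram law evaluates the bound. *)
Lemma hermitian_bound_re (R : realType) (H : hilbertType R)
    (B : {hermitian_sym H for @Num.conj R[i]}) (c : R[i]) :
    (forall z, `|B z z| <= c * `|z| ^+ 2) ->
  forall u v, `|B u v + (B u v)^*%R| <= c * (`|u| ^+ 2 + `|v| ^+ 2).
Proof.
move=> Bc u v.
have polar : B (u + v) (u + v) - B (u - v) (u - v)
             = 2 * (B u v + (B u v)^*%R).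
  by rewrite hnormD hnormB /= expr0 mul1r; ring.
have two_gt0 : 0 < 2 :> R[i] by rewrite ltr0n.
rewrite -(ler_pM2l two_gt0) -{1}(gtr0_norm two_gt0) -normrM -polar.
apply: (le_trans (ler_normB _ _)); apply: (le_trans (lerD (Bc _) (Bc _))).
by rewrite -mulrDr parallelogram mulrCA.
Qed.

(** The previous bound is applied to multiples of [x] and [y] that make
    [B x y] nonnegative and the two vectors equal in norm, which is the equality
    case of the arithmetic-geometric mean inequality. *)
Lemma hermitian_bound (R : realType) (H : hilbertType R)
    (B : {hermitian_sym H for @Num.conj R[i]}) (c : R[i]) :
    (forall z, `|B z z| <= c * `|z| ^+ 2) ->
  forall x y, `|B x y| <= c * (`|x| * `|y|).
Proof.
move=> Bc x y.
have [->|x0] := eqVneq x 0; first by rewrite linear0l !normr0 mul0r mulr0.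
have [->|y0] := eqVneq y 0; first by rewrite linear0r !normr0 !mulr0.
have [d0|d0] := eqVneq (B x y) 0.
  (* What remains is [0 <= c], which the hypothesis at [x != 0] forces. *)
  rewrite d0 normr0; apply: mulr_ge0; last exact: mulr_ge0.
  have := le_trans (normr_ge0 _) (Bc x).
  by rewrite pmulr_lge0 // exprn_gt0 // normr_gt0.
move: d0; set d : R[i] := B x y => d0.
have p_gt0 : 0 < `|x| * `|y| * `|d| ^+ 2.
  by rewrite !mulr_gt0 ?exprn_gt0 ?normr_gt0.
have two_gt0 : 0 < 2 :> R[i] by rewrite ltr0n.
have conj_ge0 (r : R[i]) : 0 <= r -> Num.conj r = r.
  by move=> r0; apply/CrealP; exact: ger0_real.
have := hermitian_bound_re Bc ((`|y| * d^*%R) *: x) ((`|x| * `|d|) *: y).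
rewrite linearZl_LR linearZr_LR /= -/d !normrZ norm_conjC !normr_id.
rewrite [(`|x| * `|d|)^*%R]conj_ge0 ?mulr_ge0 //.
have -> : `|y| * d^*%R * (`|x| * `|d| * d) = `|x| * `|y| * `|d| ^+ 2 * `|d|.
  by rewrite normCK; ring.
rewrite conj_ge0; last by rewrite mulr_ge0 // ltW.
set p := `|x| * `|y| * `|d| ^+ 2 in p_gt0 *.
have -> : p * `|d| + p * `|d| = 2 * p * `|d| by ring.
rewrite ger0_norm; last by rewrite !mulr_ge0 // ltW.
have -> : c * ((`|y| * `|d| * `|x|) ^+ 2 + (`|x| * `|d| * `|y|) ^+ 2)
          = 2 * p * (c * (`|x| * `|y|)) by rewrite /p; ring.
by rewrite ler_pM2l // mulr_gt0.
Qed.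

Lemma opnorm_has_ubound (R : realType) (H : hilbertType R)
    (T : {linear H -> H}) : bounded_operator T ->
  has_ubound [set complex.Re `|T x| | x in [set x : H | `|x| <= 1]]%classic.
Proof.
move=> [M TM]; exists `|M| => _ [u /= u1 <-].
rewrite -lecR RRe_real ?normr_real //.
apply: (le_trans (TM u)); apply: (@le_trans _ _ (`|M|%:C * `|u|)).
  by apply: ler_wpM2r => //; rewrite lecR ler_norm.
by apply: ler_piMr => //; rewrite ler0c.
Qed.

Lemma opnorm_ge0 (R : realType) (H : hilbertType R) (T : {linear H -> H}) :
  bounded_operator T -> 0 <= opnorm T.
Proof.
move=> Tb; apply: ub_le_sup; first exact: opnorm_has_ubound.
by exists 0; rewrite /= ?linear0 normr0.
Qed.

Lemma le_opnorm (R : realType) (H : hilbertType R) (T : {linear H -> H}) :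
  bounded_operator T -> forall z, `|T z| <= (opnorm T)%:C * `|z|.
Proof.
move=> Tb.
have le1 (w : H) : `|w| <= 1 -> `|T w| <= (opnorm T)%:C.
  move=> w1; rewrite -[leLHS]RRe_real ?normr_real // lecR.
  by apply: ub_le_sup; [exact: opnorm_has_ubound | exists w].
move=> z; have [->|z0] := eqVneq z 0; first by rewrite linear0 !normr0 mulr0.
have nz : 0 < `|z| by rewrite normr_gt0.
have := le1 (`|z|^-1 *: z).
rewrite linearZ !normrZ normfV normr_id mulVf ?gt_eqF // => /(_ (lexx _)).
by rewrite mulrC ler_pdivrMr.
Qed.

(** Named so that it can carry the bilinear and Hermitian structures which
    [hermitian_bound] asks for; [c] is taken in [R] because the form is
    Hermitian only for real [c]. *)
Definition recentred_form (R : realType) (H : hilbertType R)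
    (T : {linear H -> H}) (c : R) (x y : H) : R[i] :=
  inner (T x) (T y) - c%:C * inner x y.

Section RecentredForm.
Variables (R : realType) (H : hilbertType R) (T : {linear H -> H}) (c : R).

Lemma recentred_form_bilinear :
  bilinear_for (GRing.Scale.Law.clone _ _ *%R _)
    (GRing.Scale.Law.clone _ _ (@Num.conj R[i] \; *%R) _)
    (recentred_form T c : H -> H -> R[i]).
Proof.
split=> u a v w; rewrite /recentred_form.
  rewrite (linearP T) !(linearPl inner) /=.
  by move: (c%:C) => k; ring.
rewrite (linearP T) !(linearPr inner) /GRing.Scale.Law.phant_clone /=.
by move: (c%:C) (a^*%R) => k b; ring.
Qed.

HB.instance Definition _ :=
  bilinear_isBilinear.Build R[i] H H R[i] _ _ (recentred_form T c)
    recentred_form_bilinear.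

Lemma recentred_form_hermitian u v :
  recentred_form T c u v
  = (-1) ^+ false * Num.conj (recentred_form T c v u).
Proof.
rewrite /recentred_form expr0 mul1r rmorphB rmorphM /=.
rewrite [Num.conj _%:C](conjc_real c).
by rewrite hermC (hermC _ u v) /= !expr0 !mul1r.
Qed.

HB.instance Definition _ :=
  isHermitianSesquilinear.Build R[i] H false (@Num.conj R[i])
    (recentred_form T c) recentred_form_hermitian.

End RecentredForm.

Theorem theorem3p3 (R : realType) (H : hilbertType R)
    (H_nontrivial : nontrivial_space H) (H_separable : separable_space H)
    (T : {linear H -> H}) (T_bounded : bounded_operator T)
    (T_neq0 : (T : H -> H) <> \0) (x y : H) :
  let c : R[i] := (opnorm T ^+ 2 / 2)%:C in
  `| inner (T x) (T y) - c * inner x y | <= c * (`|x| * `|y|)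
  /\ (`| inner (T x) (T y) | <= `| inner (T x) (T y) - c * inner x y | + c * `| inner x y |
      /\ `| inner (T x) (T y) - c * inner x y | + c * `| inner x y |
         <= c * (`| inner x y | + `|x| * `|y|)).
Proof.
move=> c.
have c_ge0 : 0 <= c by rewrite ler0c divr_ge0 // sqr_ge0.
have quad z : `|recentred_form T (opnorm T ^+ 2 / 2) z z| <= c * `|z| ^+ 2.
  have Tz : `|T z| ^+ 2 <= 2 * (c * `|z| ^+ 2).
    have -> : 2 * (c * `|z| ^+ 2) = ((opnorm T)%:C * `|z|) ^+ 2.
      by rewrite /c rmorphM fmorphV rmorphXn rmorph_nat /=; field.
    rewrite ler_sqr ?nnegrE ?mulr_ge0 ?ler0c ?opnorm_ge0 //.
    exact: le_opnorm.
  rewrite /recentred_form !inner_normE -/c real_ler_norml; last first.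
    by rewrite rpredB ?ger0_real ?mulr_ge0 ?exprn_ge0.
  apply/andP; split.
    by rewrite lerBrDr addNr exprn_ge0.
  by rewrite lerBlDr -mulr2n -[leRHS]mulr_natl.
have first_bound := hermitian_bound quad x y.
rewrite /recentred_form -/c in first_bound.
split=> //; split; last by rewrite addrC mulrDr lerD2l.
rewrite -{1}[inner (T x) (T y)](subrK (c * inner x y)).
by rewrite (le_trans (ler_normD _ _)) // normrM (ger0_norm c_ge0).
Qed.
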